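(* Let $p=p(n)\in(0,1)$ satisfy $1-p=\Omega(1)$, and let $\ell=\ell(n)$ be a positive integer with $\ell=o(n\sqrt{p})$. Let $X_{n,\ell}$ be the number of $\ell$-matchings contained in $\mathcal{G}(n,p)$, let $\lambda_{n,\ell}=\mathbf{E}X_{n,\ell}=\binom{n}{2\ell}\frac{(2\ell)!}{2^\ell \ell!}p^\ell$, and let $$\bar{\sigma}=\bar\sigma_{n,\ell}=\left(\ell \binom{n}{2\ell}\binom{n-2}{2\ell-2}(2\ell-1)!!\,(2\ell-3)!!\,(p^{2\ell-1}-p^{2\ell})\right)^{1/2}.$$ Then for every fixed integer $k\ge 2$, as $n\to\infty$, $$\mathbf{E}\big((X_{n,\ell}-\lambda_{n,\ell})^k\big)=\begin{cases}(1+o(1))(k-1)!!\,\bar\sigma^k, & k \text{ even},\\ o(\bar\sigma^k), & k\text{ odd}.\end{cases}$$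
   Context: $\mathcal{G}(n,p)$ is the binomial random graph on vertex set $[n]$ in which each edge is present independently with probability $p$. An $\ell$-matching is a matching with exactly $\ell$ edges, and $X_{n,\ell}$ counts subgraphs of $\mathcal{G}(n,p)$ isomorphic to an $\ell$-matching. For a real number $m\ge 1$, $m!!=\prod_{i=0}^{\lfloor (m-1)/2\rfloor}(m-2i)$ (empty products, e.g. when $m<1$, are $1$). All asymptotics are as $n\to\infty$; $1-p=\Omega(1)$ means $1-p$ is bounded away from $0$. *)

(* Defs.v *)
From mathcomp Require Export all_boot all_order all_algebra.
From mathcomp Require Export classical_sets functions reals topology normedtype landau.
Export Order.TTheory GRing.Theory Num.Theory.
Export numFieldNormedType.Exports.

Set Implicit Arguments.
Unset Strict Implicit.
Unset Printing Implicit Defensive.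

Local Open Scope ring_scope.

(* Vertices are 'I_n, and a graph is its set of edges: a subset of
   complete_graph n. *)
Definition complete_graph (n : nat) : {set {set 'I_n}} :=
  [set e : {set 'I_n} | #|e| == 2%N].

Definition is_graph (n : nat) (G : {set {set 'I_n}}) : bool :=
  G \subset complete_graph n.

(* Product of the Bernoulli(p) weights of the individual edges. *)
Definition Gnp_weight (R : realType) (n : nat) (p : R)
    (G : {set {set 'I_n}}) : R :=
  \prod_(e in complete_graph n) (if e \in G then p else 1 - p).

Definition Gnp_expectation (R : realType) (n : nat) (p : R)
    (Y : {set {set 'I_n}} -> R) : R :=
  \sum_(G : {set {set 'I_n}} | is_graph G) Gnp_weight p G * Y G.

Definition is_matching (n l : nat) (M : {set {set 'I_n}}) : bool :=
  [&& is_graph M, finset.trivIset M & #|M| == l].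

(* A matching has no isolated vertices, so a copy of the l-matching in G is
   determined by its edge set; copies are unlabelled. *)
Definition num_matchings (n l : nat) (G : {set {set 'I_n}}) : nat :=
  #|[set M : {set {set 'I_n}} | is_matching l M & M \subset G]|.

Definition mean_matchings (R : realType) (n l : nat) (p : R) : R :=
  Gnp_expectation p (fun G : {set {set 'I_n}} => (num_matchings l G)%:R).

Definition central_moment (R : realType) (n l : nat) (p : R) (k : nat) : R :=
  Gnp_expectation p (fun G : {set {set 'I_n}} =>
    ((num_matchings l G)%:R - mean_matchings n l p) ^+ k).

(* m!! is the product of m - 2i over 0 <= i <= floor ((m - 1) / 2); there are
   floor ((m + 1) / 2) factors, and Num.truncn is 0 on negative reals, so the
   product is empty exactly when m < 1. *)
Definition double_factorial (R : realType) (m : R) : R :=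
  \prod_(i < Num.truncn ((m + 1) / 2)) (m - 2 * i%:R).

(* For l >= 1 the truncated subtractions are harmless: only n - 2 may truncate,
   and then 'C(n, 2 * l) = 0. *)
Definition sigma_bar (R : realType) (n l : nat) (p : R) : R :=
  Num.sqrt (l%:R * 'C(n, 2 * l)%:R * 'C(n - 2, 2 * l - 2)%:R
    * double_factorial (2 * l%:R - 1) * double_factorial (2 * l%:R - 3)
    * (p ^+ (2 * l - 1) - p ^+ (2 * l))).

(* Main.v *)
Require Import Defs.
From mathcomp Require Import ring lra zify.
From mathcomp Require Import sequences exp.

(** Write xi_e = 1[e in G] - p.  Expanding prod_(e in M) (p + xi_e) over all
    matchings M gives X - lambda = sum_(S nonempty) c_S xi_S, where xi_S is the
    product of the xi_e over e in S and c_S = p^(l - |S|) times the number of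
    l-matchings containing S.  Let a be the common value of c_S for |S| = 1 and
    N = C(n, 2); then sigma_bar^2 = a^2 N p (1 - p) exactly.

    Put T = sqrt (N p).  Since l = o(n sqrt p), one has
    c_S T^|S| <= o(1) a T uniformly over |S| >= 2.  In the expansion of
    E (X - lambda)^k over k-tuples (S_1, ..., S_k), an edge covered exactly once
    kills the tuple and every other covered edge contributes at most p.  Dropping
    the condition that the S_i be matchings, the sum of T^-(|S_1| + ... + |S_k|)
    |E xi_(S_1) ... xi_(S_k)| factors over the edges and is at most
    (1 + 2^k p T^-2)^N <= exp (2^k).  So only the tuples of singletons matter, up
    to o(sigma_bar^k), and these give a^k times the k-th central moment of the
    binomial distribution with parameters N and p, where N p (1 - p) -> oo. *)

Local Open Scope ring_scope.

(** * Expansion in centered edge indicators *)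

(** Independence of the edges: distributing the product over the sums yields one term per edge set,
    with exactly the weight of that graph. *)
Lemma Gnp_expectation_prod {R : realType} {n : nat} (p : R)
    (f : {set 'I_n} -> bool -> R) :
  Gnp_expectation p
    (fun G : {set {set 'I_n}} => \prod_(e in complete_graph n) f e (e \in G))
  = \prod_(e in complete_graph n) (p * f e true + (1 - p) * f e false).
Proof.
pose E := complete_graph n.
(* Off the complete graph the factors are 0 and 1, so the product can run over all vertex sets while
   a set with a non-edge contributes 0. *)
pose F (e : {set 'I_n}) := if e \in E then p * f e true else 0.
pose F' (e : {set 'I_n}) := if e \in E then (1 - p) * f e false else 1.
transitivity (\prod_e (F e + F' e)); last first.
  rewrite [RHS]big_mkcond; apply: eq_bigr => e _; rewrite /F /F'.
  by case: ifP; rewrite // add0r.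
rewrite bigA_distr /Gnp_expectation big_mkcond; apply: eq_bigr => G _.
rewrite /is_graph; case: ifPn => [/fintype.subsetP GE | /fintype.subsetPn[e eG eE]].
  rewrite /Gnp_weight -big_split [LHS]big_mkcond; apply: eq_bigr => e _ /=.
  rewrite /F /F' -/E; case: ifPn => eE; first by case: ifP.
  by rewrite ifN //; apply: contra eE; apply: GE.
by rewrite (bigD1 e) //= eG /F (negPf eE) mul0r.
Qed.

Lemma Gnp_expectation_sum {R : realType} {n : nat} (p : R) (I : finType)
    (P : pred I) (Y : I -> {set {set 'I_n}} -> R) :
  Gnp_expectation p (fun G => \sum_(i | P i) Y i G)
  = \sum_(i | P i) Gnp_expectation p (Y i).
Proof.
rewrite /Gnp_expectation exchange_big; apply: eq_bigr => G _.
by rewrite mulr_sumr.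
Qed.

Lemma Gnp_expectationZ {R : realType} {n : nat} (p a : R)
    (Y : {set {set 'I_n}} -> R) :
  Gnp_expectation p (fun G => a * Y G) = a * Gnp_expectation p Y.
Proof.
by rewrite mulr_sumr; apply: eq_bigr => G _; rewrite mulrCA.
Qed.

Lemma eq_Gnp_expectation {R : realType} {n : nat} (p : R)
    (Y Z : {set {set 'I_n}} -> R) :
  (forall G, is_graph G -> Y G = Z G) ->
  Gnp_expectation p Y = Gnp_expectation p Z.
Proof. by move=> YZ; apply: eq_bigr => G GE; rewrite YZ. Qed.

(** The [j]-th central moment of an indicator of mean [p]. *)
Definition bernoulli_moment {R : realType} (p : R) (j : nat) : R :=
  p * (1 - p) ^+ j + (1 - p) * (- p) ^+ j.

Definition centered_prod {R : realType} {n : nat} (p : R)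
    (S G : {set {set 'I_n}}) : R :=
  \prod_(e in S) ((e \in G)%:R - p).

(** Swapping the two products groups the factors by edge; independence then leaves one central
    moment per edge. *)
Lemma Gnp_expectation_centered {R : realType} {n k : nat} (p : R)
    (S : 'I_k -> {set {set 'I_n}}) :
  (forall i, S i \subset complete_graph n) ->
  Gnp_expectation p (fun G => \prod_i centered_prod p (S i) G)
  = \prod_(e in complete_graph n) bernoulli_moment p #|[set i | e \in S i]|.
Proof.
move=> SE.
pose f (e : {set 'I_n}) (b : bool) : R := (b%:R - p) ^+ #|[set i | e \in S i]|.
transitivity (Gnp_expectation p (fun G : {set {set 'I_n}} =>
  \prod_(e in complete_graph n) f e (e \in G))).
  apply: eq_Gnp_expectation => G _; rewrite /centered_prod.
  rewrite (exchange_big_dep (mem (complete_graph n))) => [|i e _]; last first.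
    exact: (fintype.subsetP (SE i)).
  apply: eq_bigr => e _; rewrite /f -prodr_const.
  by apply: eq_bigl => i; rewrite inE.
rewrite Gnp_expectation_prod; apply: eq_bigr => e _.
by rewrite /f /bernoulli_moment sub0r.
Qed.

Definition num_extensions {n : nat} (l : nat) (S : {set {set 'I_n}}) : nat :=
  #|[set M : {set {set 'I_n}} | is_matching l M & S \subset M]|.

(** The [c_S] of the overview. Truncation in [l - #|S|] is harmless, since sets with more than [l]
    edges have no extension. *)
Definition matching_coef {R : realType} {n : nat} (l : nat) (p : R)
    (S : {set {set 'I_n}}) : R :=
  p ^+ (l - #|S|) * (num_extensions l S)%:R.

Lemma num_matchings_centered {R : realType} {n l : nat} (p : R)
    (G : {set {set 'I_n}}) :
  (num_matchings l G)%:R =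
  \sum_(S : {set {set 'I_n}}) matching_coef l p S * centered_prod p S G.
Proof.
(* The indicator of [M \subset G], with [p] subtracted and added back in every factor. *)
transitivity (\sum_(M : {set {set 'I_n}} | is_matching l M)
    \prod_(e in M) ((e \in G)%:R - p + p)).
  rewrite /num_matchings -sum1_card natr_sum big_mkcond [RHS]big_mkcond.
  apply: eq_bigr => M _; rewrite inE; case: (is_matching l M) => //=.
  case: ifPn => [/fintype.subsetP MG | /fintype.subsetPn[e eM eG]].
    by rewrite big1 // => e /MG ->; rewrite subrK.
  by rewrite (bigD1 e) //= (negPf eG) subrK mul0r.
transitivity (\sum_(M : {set {set 'I_n}} | is_matching l M)
   \sum_(S : {set {set 'I_n}} | S \subset M)
      p ^+ (l - #|S|) * centered_prod p S G).
  apply: eq_bigr => M /and3P[_ _ /eqP <-].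
  pose F e := if e \in M then (e \in G)%:R - p else 0.
  pose F' e := if e \in M then p else 1.
  transitivity (\prod_e (F e + F' e)).
    rewrite [LHS]big_mkcond; apply: eq_bigr => e _; rewrite /F /F'.
    by case: ifP; rewrite // add0r.
  rewrite bigA_distr [RHS]big_mkcond; apply: eq_bigr => S _.
  case: ifPn => [SM | /fintype.subsetPn[e eS eM]]; last first.
    by rewrite (bigD1 e) //= eS /F (negPf eM) mul0r.
  rewrite (bigID (mem S)) /= mulrC; congr (_ * _).
    rewrite -cardsDS // -prodr_const [RHS]big_mkcond [LHS]big_mkcond.
    apply: eq_bigr => e _; rewrite !inE /F'; case: (e \in S) => //=.
  apply: eq_bigr => e eS; rewrite eS /F (fintype.subsetP SM) //.
rewrite (exchange_big_dep predT) //=; apply: eq_bigr => S _.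
rewrite /matching_coef mulr_natr -sumr_const mulr_suml.
by apply: eq_bigl => M; rewrite inE.
Qed.

(** * Counting matchings through a given matching *)

Lemma card_matching_edge {n s : nat} {S : {set {set 'I_n}}} {e : {set 'I_n}} :
  is_matching s S -> e \in S -> #|e| = 2%N.
Proof.
by case/and3P=> /fintype.subsetP SE _ _ /SE; rewrite inE => /eqP.
Qed.

Lemma card_cover_matching {n s : nat} {S : {set {set 'I_n}}} :
  is_matching s S -> #|finset.cover S| = (2 * s)%N.
Proof.
move=> mS; have /and3P[_ /eqP <- /eqP <-] := mS.
by rewrite mulnC -sum_nat_const; apply: eq_bigr => e; apply: card_matching_edge mS.
Qed.

(** Disjointness forces a new edge off all covered vertices, so one-edge extensions are counted by a
    single binomial coefficient. *)
Lemma is_matchingU1 {n s : nat} {S : {set {set 'I_n}}} (e : {set 'I_n}) :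
  is_matching s S ->
  (e \notin S) && is_matching s.+1 (e |: S)
  = (e \subset ~: finset.cover S) && (#|e| == 2).
Proof.
move=> mS; have /and3P[gS tS /eqP cS] := mS.
rewrite -finset.disjoints_subset.
apply/andP/andP => [[eS /and3P[gU tU _]] | [dis ce]].
  split; last first.
    by have /fintype.subsetP/(_ e) := gU; rewrite !inE eqxx; apply.
  apply/finset.bigcup_disjointP => f fS.
  rewrite disjoint_sym; have /finset.trivIsetP := tU; apply.
  - by rewrite !inE fS orbT.
  - by rewrite !inE eqxx.
  - by apply: contraNneq eS => <-.
(* Excluding the empty block lets [trivIsetU1] conclude that [e] is new as well as disjoint from the
   rest. *)
have S0 : finset.set0 \notin S.
  by apply/negP => /(card_matching_edge mS); rewrite cards0.
have [|tU eS] := finset.trivIsetU1 (A := e) _ tS S0.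
  by move=> f fS; apply: disjointWr dis; apply: finset.bigcup_sup fS.
split=> //; apply/and3P; split=> //; last by rewrite cardsU1 eS cS.
by apply/fintype.subsetP => f; rewrite !inE => /predU1P[-> //|/(card_matching_edge mS)->].
Qed.

(** Double counting of pairs [(e, M)]: each [M] containing [S] has [l - s] edges outside [S]. *)
Lemma sum_num_extensions {n l s : nat} {S : {set {set 'I_n}}} :
  is_matching s S ->
  (\sum_(e : {set 'I_n} | (e \notin S) && is_matching s.+1 (e |: S))
     num_extensions l (e |: S)
   = (l - s) * num_extensions l S)%N.
Proof.
move=> mS; have /and3P[gS tS /eqP cS] := mS.
rewrite mulnC /num_extensions -sum_nat_const.
under [LHS]eq_bigr => e _ do rewrite -sum1_card.
rewrite (exchange_big_dep
  (mem [set M | is_matching l M & S \subset M])) => [|e M _]; last first.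
  by rewrite !inE => /andP[-> /(fintype.subset_trans _)->//]; rewrite finset.subsetUr.
apply: eq_bigr => M; rewrite /= inE => /andP[mM SM].
have /and3P[gM tM /eqP cM] := mM.
have -> : (l - s = #|M :\: S|)%N by rewrite cardsDS // cM cS.
rewrite -sum1_card; apply: eq_bigl => e.
rewrite !inE mM /= finset.subUset finset.sub1set SM andbT.
case eS: (e \in S) => //=; case eM: (e \in M); rewrite ?andbF //= andbT.
have UM : e |: S \subset M by rewrite finset.subUset finset.sub1set eM.
apply/and3P; split; last by rewrite cardsU1 eS cS.
- exact: fintype.subset_trans gM.
- by apply/finset.trivIsetP => f g fU gU; have /finset.trivIsetP := tM; apply;
    apply: (fintype.subsetP UM).
Qed.

(** Both sides count the ways to add edges one at a time until [S] has [l] edges: with [i] edges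
    present there are ['C(n - 2 * i, 2)] choices, and each final matching arises in [(l - s)!]
    orders. *)
Lemma num_extensionsE {n l s : nat} {S : {set {set 'I_n}}} :
  is_matching s S -> (s <= l)%N ->
  ((l - s)`! * num_extensions l S = \prod_(s <= i < l) 'C(n - 2 * i, 2))%N.
Proof.
move=> mS sl; have [d dE] : exists d, d = (l - s)%N by exists (l - s)%N.
elim: d s S mS sl dE => [|d IH] s S mS sl dE.
  rewrite -dE mul1n big_geq; last by lia.
  rewrite -[RHS](cards1 S); apply: eq_card => M; rewrite !inE.
  have ls : l = s by lia.
  apply/andP/eqP => [[/and3P[_ _ /eqP cM] SM] | ->]; last by rewrite ls.
  apply/esym/eqP; rewrite eqEcard SM cM.
  by have /and3P[_ _ /eqP ->] := mS; lia.
have lts : (s < l)%N by lia.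
rewrite -dE factS -mulnA mulnCA dE -sum_num_extensions // big_distrr /=.
under eq_bigr => e /andP[_ mU].
  have dl : d = (l - s.+1)%N by lia.
  rewrite [X in X`!]dl (IH s.+1 _ mU) //; over.
rewrite [RHS]big_ltn // sum_nat_cond_const; congr (_ * _)%N.
transitivity #|[set e : {set 'I_n} | e \subset ~: finset.cover S & #|e| == 2%N]|.
  by apply: eq_card => e; rewrite !inE is_matchingU1.
rewrite cards_draws; congr 'C(_, _).
have := cardsC (finset.cover S); rewrite (card_cover_matching mS) card_ord => cn.
by lia.
Qed.

(** Two consecutive factors of the falling factorial [m ^_ (2 * r)] make up
    [2 * 'C(m - 2 * i, 2)]. *)
Lemma prod_bin2 (m r : nat) :
  (\prod_(i < r) 'C(m - 2 * i, 2) * 2 ^ r = 'C(m, 2 * r) * (2 * r)`!)%N.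
Proof.
rewrite bin_ffact; elim: r => [|r IH]; first by rewrite big_ord0.
rewrite big_ord_recr /= expnS.
have -> : (2 * r.+1 = (2 * r).+2)%N by lia.
rewrite !ffactnSr -IH; have := bin_ffact (m - 2 * r) 2.
rewrite ffactnSr ffactn1 (_ : (m - 2 * r - 1) = (m - (2 * r).+1))%N; last by lia.
by rewrite (_ : 2`! = 2)%N // => h; rewrite -[RHS]mulnA -h; ring.
Qed.

(** * Central moments of the binomial distribution *)

Definition binomial_central_moment {R : realType} (p : R) (N k : nat) : R :=
  \sum_(j < N.+1)
    'C(N, j)%:R * p ^+ j * (1 - p) ^+ (N - j) * (j%:R - N%:R * p) ^+ k.

(** Conditioning on one trial: Pascal's rule splits the sum by its outcome. *)
Lemma binomial_sumS {R : realType} (p q : R) (N : nat) (f : nat -> R) :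
  \sum_(j < N.+2) 'C(N.+1, j)%:R * p ^+ j * q ^+ (N.+1 - j) * f j
  = \sum_(j < N.+1) 'C(N, j)%:R * p ^+ j * q ^+ (N - j) * (p * f j.+1 + q * f j).
Proof.
rewrite big_ord_recl /=; under eq_bigr => i _.
  rewrite /bump /= add1n binS natrD subSS !mulrDl; over.
rewrite big_split /= addrA.
under [RHS]eq_bigr => i _ do rewrite mulrDr.
rewrite big_split /= addrC; congr (_ + _).
  by apply: eq_bigr => i _; rewrite exprS; ring.
rewrite [RHS]big_ord_recl [in LHS]big_ord_recr /= (@bin_small N N.+1) // !mul0r addr0.
rewrite !bin0 !subn0 (exprS q); congr (_ + _); first by ring.
apply: eq_bigr => i _; rewrite /bump /= add1n.
by rewrite -{1}(subnSK (ltn_ord i)) (exprS q); ring.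
Qed.

(** The extra trial adds an independent centered indicator, and the binomial theorem expands the
    power of the sum. *)
Lemma binomial_central_momentS {R : realType} (p : R) (N k : nat) :
  binomial_central_moment p N.+1 k
  = \sum_(i < k.+1)
      'C(k, i)%:R * bernoulli_moment p i * binomial_central_moment p N (k - i).
Proof.
rewrite /binomial_central_moment
  (binomial_sumS _ _ _ (fun j => (j%:R - N.+1%:R * p) ^+ k)).
under [RHS]eq_bigr => i _ do rewrite mulr_sumr.
rewrite exchange_big /=; apply: eq_bigr => j _.
have -> : j.+1%:R - N.+1%:R * p = (j%:R - N%:R * p) + (1 - p) by ring.
have -> : j%:R - N.+1%:R * p = (j%:R - N%:R * p) + - p by ring.
rewrite !exprDn !mulr_sumr -big_split mulr_sumr; apply: eq_bigr => i _ /=.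
by rewrite /bernoulli_moment; ring.
Qed.

Lemma binomial_central_moment0 {R : realType} (p : R) (N : nat) :
  binomial_central_moment p N 0 = 1.
Proof.
rewrite -[RHS](expr1n _ N) -[in RHS](subrK p 1) exprDn.
by apply: eq_bigr => i _; rewrite expr0 mulr1 -mulr_natl; ring.
Qed.

Lemma bernoulli_moment0 {R : realType} (p : R) : bernoulli_moment p 0 = 1.
Proof. by rewrite /bernoulli_moment; ring. Qed.

Lemma bernoulli_moment1 {R : realType} (p : R) : bernoulli_moment p 1 = 0.
Proof. by rewrite /bernoulli_moment; ring. Qed.

Lemma bernoulli_moment2 {R : realType} (p : R) :
  bernoulli_moment p 2 = p * (1 - p).
Proof. by rewrite /bernoulli_moment; ring. Qed.

(** From order 2 on, a factor [p * (1 - p)] splits off and what remains is at most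
    [(1 - p) + p = 1]. *)
Lemma normr_bernoulli_moment {R : realType} (p : R) (j : nat) :
  0 <= p <= 1 -> `|bernoulli_moment p j.+2| <= p * (1 - p).
Proof.
move=> /andP[p0 p1]; rewrite /bernoulli_moment.
have q0 : 0 <= 1 - p by lra.
apply: (le_trans (ler_normD _ _)).
have -> : `|p * (1 - p) ^+ j.+2| = p * (1 - p) ^+ j.+2.
  by rewrite ger0_norm // mulr_ge0 // exprn_ge0.
have -> : `|(1 - p) * (- p) ^+ j.+2| = (1 - p) * p ^+ j.+2.
  by rewrite normrM (ger0_norm q0) normrX normrN (ger0_norm p0).
rewrite !(exprS _ j.+1).
have a : (1 - p) ^+ j.+1 <= 1 - p by rewrite exprS ler_piMr // exprn_ile1 //; lra.
have b : p ^+ j.+1 <= p by rewrite exprS ler_piMr // exprn_ile1.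
have : p * (1 - p) * ((1 - p) ^+ j.+1 + p ^+ j.+1) <= p * (1 - p) * 1.
  by apply: ler_wpM2l; [apply: mulr_ge0|lra].
lra.
Qed.

(** In the recursion the term of order 0 is the old moment and the term of order 1 vanishes, so the
    variance term leads the increment. *)
Lemma binomial_central_moment_diff {R : realType} (p : R) (N k : nat) :
  binomial_central_moment p N.+1 k.+2 - binomial_central_moment p N k.+2
  = 'C(k.+2, 2)%:R * (p * (1 - p)) * binomial_central_moment p N k
    + \sum_(i < k) 'C(k.+2, i.+3)%:R * bernoulli_moment p i.+3
        * binomial_central_moment p N (k - i.+1).
Proof.
rewrite binomial_central_momentS 3!big_ord_recl /= /bump /= !subn0 !add1n.
rewrite bernoulli_moment0 bernoulli_moment1 bernoulli_moment2 bin0.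
rewrite mulr0 mul0r add0r !mul1r addrAC subrr add0r; congr (_ + _).
  by rewrite !subSS subn0.
Qed.

Lemma binomial_central_moment_N0 {R : realType} (p : R) (k : nat) :
  binomial_central_moment p 0 k.+1 = 0.
Proof. by rewrite /binomial_central_moment big_ord1 mul0r subr0 expr0n mulr0. Qed.

Lemma binomial_central_moment1 {R : realType} (p : R) (N : nat) :
  binomial_central_moment p N 1 = 0.
Proof.
elim: N => [|N IH]; first exact: binomial_central_moment_N0.
rewrite binomial_central_momentS !big_ord_recl big_ord0 /= bernoulli_moment1.
by rewrite IH !mulr0 mul0r !addr0.
Qed.

Lemma binomial_central_moment2 {R : realType} (p : R) (N : nat) :
  binomial_central_moment p N 2 = N%:R * (p * (1 - p)).
Proof.
elim: N => [|N IH]; first by rewrite binomial_central_moment_N0 mul0r.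
have := binomial_central_moment_diff p N 0.
rewrite big_ord0 addr0 binomial_central_moment0 binn => /eqP.
by rewrite subr_eq IH => /eqP ->; rewrite -natr1; ring.
Qed.

(** Moments of the standard normal law: [(k - 1)!!] for even [k] and 0 for odd [k], so that one
    estimate serves both parities. *)
Fixpoint gaussian_moment (k : nat) : nat :=
  match k with
  | 0 => 1
  | 1 => 0
  | k'.+2 => (k'.+1 * gaussian_moment k')%N
  end.

Lemma gaussian_moment_odd (k : nat) : odd k -> gaussian_moment k = 0%N.
Proof.
have [m] := ubnP k; elim: m k => // m IH [|[|k]] //= km; rewrite negbK => ok.
by rewrite IH ?muln0 //; lia.
Qed.

(** The remainder obeys [r_(a+1) = (V + v) * r_a + (a + 1) * v ^+ 2 * V ^+ a], which induction sums
    up. At [a = 0] the constant is 0, so the truncated [a.-1] is harmless. *)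
Lemma exprD_taylor2 {R : realType} (V v y : R) (a : nat) :
  0 <= V -> 0 <= v -> V + v <= y ->
  `|(V + v) ^+ a.+1 - V ^+ a.+1 - a.+1%:R * v * V ^+ a|
    <= (a.+1 * a)%:R * v ^+ 2 * y ^+ a.-1.
Proof.
move=> V0 v0 Vy.
have y0 : 0 <= y by lra.
elim: a => [|a IH].
  have -> : (V + v) ^+ 1 - V ^+ 1 - 1%:R * v * V ^+ 0 = 0 by ring.
  by rewrite normr0 muln0 !mul0r.
have -> : (V + v) ^+ a.+2 - V ^+ a.+2 - a.+2%:R * v * V ^+ a.+1
  = (V + v) * ((V + v) ^+ a.+1 - V ^+ a.+1 - a.+1%:R * v * V ^+ a)
     + a.+1%:R * v ^+ 2 * V ^+ a.
  by rewrite !(exprS _ a.+1) -!natr1 (exprS V a); ring.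
apply: (le_trans (ler_normD _ _)).
have n0 : 0 <= a.+1%:R * v ^+ 2 * V ^+ a by rewrite !mulr_ge0 // exprn_ge0.
rewrite normrM [X in X * _ + _]ger0_norm; last lra.
rewrite (ger0_norm n0) /=.
have h1 : a.+1%:R * v ^+ 2 * V ^+ a <= a.+1%:R * v ^+ 2 * y ^+ a.
  by rewrite ler_wpM2l ?mulr_ge0 ?exprn_ge0 // lerXn2r ?nnegrE //; lra.
have h2 : (V + v) * `|(V + v) ^+ a.+1 - V ^+ a.+1 - a.+1%:R * v * V ^+ a|
   <= (a.+1 * a)%:R * v ^+ 2 * y ^+ a.
  case: a IH {h1 n0} => [|a] IH /=.
    by move: IH; rewrite muln0 !mul0r normr_le0 => /eqP ->; rewrite normr0 mulr0.
  rewrite (exprS y) mulrCA; by rewrite ler_pM //; lra.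
have h3 : (a.+1 * a)%:R + a.+1%:R <= (a.+2 * a.+1)%:R :> R.
  by rewrite -natrD ler_nat; lia.
apply: (le_trans (lerD h2 h1)); rewrite -!mulrDl.
by rewrite ler_wpM2r ?exprn_ge0 // ler_wpM2r ?exprn_ge0.
Qed.

(** For odd [k.+3] everything vanishes; for even [k.+3] the roots disappear and the subtracted term
    is exactly the first-order Taylor term in [v]. *)
Lemma gaussian_moment_step {R : realType} (k : nat) {V v : R} :
  0 <= V -> 0 <= v <= 1 ->
  `|(gaussian_moment k.+3)%:R * (Num.sqrt (V + v) ^+ k.+3 - Num.sqrt V ^+ k.+3)
     - 'C(k.+3, 2)%:R * v * ((gaussian_moment k.+1)%:R * Num.sqrt V ^+ k.+1)|
  <= (gaussian_moment k.+3 * k.+3 ^ 2)%:R * v * (1 + Num.sqrt V) ^+ k.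
Proof.
move=> V0 /andP[v0 v1].
have [ok|ek] := boolP (odd k.+1).
  rewrite !gaussian_moment_odd //; last by rewrite /= negbK.
  by rewrite !mul0r mulr0 subr0 normr0.
have [a ka] : exists a, k.+1 = (2 * a.+1)%N by exists (k./2); lia.
have x0 : 0 <= Num.sqrt V by exact: sqrtr_ge0.
have sq (W : R) b : 0 <= W -> Num.sqrt W ^+ (2 * b) = W ^+ b.
  by move=> W0; rewrite exprM sqr_sqrtr.
have kE : k.+3 = (2 * a.+2)%N by lia.
(* With [k.+3 = 2 * a.+2] one has ['C(k.+3, 2) = a.+2 * k.+2], and [k.+2] is the factor in the
   recursion of [gaussian_moment]. *)
have cE : ('C(k.+3, 2) * gaussian_moment k.+1 = a.+2 * gaussian_moment k.+3)%N.
  have -> : 'C(k.+3, 2) = (a.+2 * k.+2)%N.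
    have := bin_ffact k.+3 2; rewrite ffactnSr ffactn1.
    by rewrite (_ : 2`! = 2)%N // subn1 /= => h; nia.
  by rewrite -mulnA.
have -> : 'C(k.+3, 2)%:R * v * ((gaussian_moment k.+1)%:R * Num.sqrt V ^+ k.+1)
  = (gaussian_moment k.+3)%:R * (a.+2%:R * v * V ^+ a.+1) :> R.
  transitivity (('C(k.+3, 2) * gaussian_moment k.+1)%:R * v * V ^+ a.+1 : R).
    by rewrite natrM ka sq //; ring.
  by rewrite cE natrM; ring.
have -> : Num.sqrt (V + v) ^+ k.+3 = (V + v) ^+ a.+2 by rewrite kE sq //; lra.
have -> : Num.sqrt V ^+ k.+3 = V ^+ a.+2 by rewrite kE sq.
rewrite -mulrBr normrM normr_nat natrM -2![leRHS]mulrA ler_wpM2l //.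
(* Since [v <= 1], the square of [1 + Num.sqrt V] dominates [V + v]; its [a]-th power has exponent
   [2 * a <= k]. *)
apply: (le_trans (@exprD_taylor2 R V v ((1 + Num.sqrt V) ^+ 2) _ _ _ _)) => //.
  by have := sqr_sqrtr V0; nra.
rewrite -exprM /= -mulrA; apply: ler_pM => //.
- by rewrite !mulr_ge0 ?exprn_ge0 //; lra.
- by rewrite ler_nat; nia.
- apply: ler_pM; rewrite ?exprn_ge0 //; first lra.
    by rewrite expr2 ler_piMr.
  by apply: ler_weXn2l; [lra|lia].
Qed.

Lemma normr_telescope {R : realType} {d : nat -> R} {N : nat} {e : R} :
  d 0%N = 0 -> (forall M, (M < N)%N -> `|d M.+1 - d M| <= e) ->
  `|d N| <= N%:R * e.
Proof.
move=> d0 he; rewrite -[d N]subr0 -d0 -(telescope_sumr _ (leq0n N)).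
rewrite big_mkord; apply: (le_trans (ler_norm_sum _ _ _)).
have -> : N%:R * e = \sum_(i < N) e by rewrite sumr_const card_ord mulr_natl.
by apply: ler_sum => i _; apply: he.
Qed.

(* With [v = p(1-p)], the first difference in [N] of the [k]-th moment is
   [C(k,2)v] times the [(k-2)]-th moment, up to lower-order terms, as is that
   of [(k-1)!! (Nv)^(k/2)]. *)
Lemma binomial_central_moment_approx {R : realType} (k : nat) :
  exists2 C : R, 0 <= C &
  forall (i N : nat) (p : R), (i <= k)%N -> 0 <= p <= 1 ->
    `|binomial_central_moment p N i
       - (gaussian_moment i)%:R * Num.sqrt (N%:R * (p * (1 - p))) ^+ i|
    <= C * (1 + Num.sqrt (N%:R * (p * (1 - p)))) ^+ i.-1.
Proof.
(* Up to order 2 the two moments agree exactly, so any constant works. *)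
have base (C : R) (i N : nat) (p : R) : 0 <= C -> (i <= 2)%N -> 0 <= p <= 1 ->
    `|binomial_central_moment p N i
       - (gaussian_moment i)%:R * Num.sqrt (N%:R * (p * (1 - p))) ^+ i|
    <= C * (1 + Num.sqrt (N%:R * (p * (1 - p)))) ^+ i.-1.
  move=> C0 i2 /andP[p0 p1].
  have V0 : 0 <= N%:R * (p * (1 - p)) by rewrite !mulr_ge0 //; lra.
  suff -> : binomial_central_moment p N i
      = (gaussian_moment i)%:R * Num.sqrt (N%:R * (p * (1 - p))) ^+ i.
    by rewrite subrr normr0 mulr_ge0 // exprn_ge0 // addr_ge0 // sqrtr_ge0.
  case: i i2 => [|[|[|i]]] //= _.
  - by rewrite binomial_central_moment0 expr0 mulr1.
  - by rewrite binomial_central_moment1 mul0r.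
  - by rewrite binomial_central_moment2 sqr_sqrtr // mul1r.
have small (k' : nat) : (k' <= 2)%N -> exists2 C : R, 0 <= C &
  forall (i N : nat) (p : R), (i <= k')%N -> 0 <= p <= 1 ->
    `|binomial_central_moment p N i
       - (gaussian_moment i)%:R * Num.sqrt (N%:R * (p * (1 - p))) ^+ i|
    <= C * (1 + Num.sqrt (N%:R * (p * (1 - p)))) ^+ i.-1.
  by move=> k2; exists 0 => // i N p ik; apply: base => //; apply: leq_trans k2.
case: k => [|[|k]]; [exact: small|exact: small|].
elim: k => [|k [C C0 IH]]; first exact: small.
(* A constant bounding all binomial moments of order at most [k.+2], read off from the induction
   hypothesis. *)
pose B := C + (\sum_(i < k.+3) gaussian_moment i)%:R.
have B0 : 0 <= B by rewrite addr_ge0.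
have hB (i N : nat) (p : R) : (i <= k.+2)%N -> 0 <= p <= 1 ->
    `|binomial_central_moment p N i|
      <= B * (1 + Num.sqrt (N%:R * (p * (1 - p)))) ^+ i.
  move=> ik p01; have := IH i N p ik p01.
  set x := Num.sqrt _; set g := (gaussian_moment i)%:R => h.
  have x0 : 0 <= x by exact: sqrtr_ge0.
  rewrite -[X in `|X|](subrK (g * x ^+ i)) /B mulrDl.
  apply: (le_trans (ler_normD _ _)); apply: lerD.
    by apply: (le_trans h); rewrite ler_wpM2l // ler_weXn2l //; [lra|lia].
  rewrite normrM normr_nat normrX ger0_norm //; apply: ler_pM => //.
  - exact: exprn_ge0.
  - by rewrite ler_nat (bigD1 (Ordinal (ik : (i < k.+3)%N))) //= leq_addr.
  - by rewrite lerXn2r ?nnegrE; lra.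
(* Three errors in one increment: replacing the moment of order [k.+1] by its Gaussian value, the
   Bernoulli moments of order at least 3, and the Taylor error. *)
pose K := 'C(k.+3, 2)%:R * C + \sum_(i < k.+1) 'C(k.+3, i.+3)%:R * B
          + (gaussian_moment k.+3 * k.+3 ^ 2)%:R : R.
have K0 : 0 <= K.
  by rewrite !addr_ge0 ?mulr_ge0 // sumr_ge0 // => i _; rewrite mulr_ge0.
exists (C + K); first exact: addr_ge0.
move=> i N p ik p01; have [p0 p1] := andP p01.
have v0 : 0 <= p * (1 - p) by rewrite mulr_ge0 //; lra.
have x0 M : 0 <= Num.sqrt (M%:R * (p * (1 - p))) by exact: sqrtr_ge0.
have [ik2|ik3] := leqP i k.+2.
  apply: (le_trans (IH i N p ik2 p01)); rewrite ler_wpM2r ?lerDl //.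
  by rewrite exprn_ge0 // addr_ge0.
have {ik ik3} -> : i = k.+3 by lia.
pose d M := binomial_central_moment p M k.+3
  - (gaussian_moment k.+3)%:R * Num.sqrt (M%:R * (p * (1 - p))) ^+ k.+3.
have step M : (M < N)%N -> `|d M.+1 - d M|
    <= K * (p * (1 - p)) * (1 + Num.sqrt (N%:R * (p * (1 - p)))) ^+ k.
  move=> MN.
  apply: (@le_trans _ _ (K * (p * (1 - p))
      * (1 + Num.sqrt (M%:R * (p * (1 - p)))) ^+ k)); last first.
    apply: ler_wpM2l; first exact: mulr_ge0.
    rewrite lerXn2r ?nnegrE ?addr_ge0 // lerD2l.
    by rewrite ler_wsqrtr // ler_wpM2r // ler_nat ltnW.
  have V0 : 0 <= M%:R * (p * (1 - p)) by rewrite mulr_ge0.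
  have v1 : 0 <= p * (1 - p) <= 1 by rewrite v0 /=; nra.
  have := gaussian_moment_step k V0 v1.
  have := IH k.+1 M p (leqnSn _) p01.
  have := binomial_central_moment_diff p M k.+1.
  set S := \sum_(_ < _) _; set v := p * (1 - p); set V := M%:R * v.
  have xM : 0 <= Num.sqrt V := x0 M.
  rewrite -/v -/V; set x := Num.sqrt V in xM *; set y := Num.sqrt (V + v).
  move=> mE h1 h2.
  have hS : `|S| <= (\sum_(i < k.+1) 'C(k.+3, i.+3)%:R * B) * v * (1 + x) ^+ k.
    apply: (le_trans (ler_norm_sum _ _ _)); rewrite !mulr_suml.
    apply: ler_sum => j _; rewrite !normrM normr_nat.
    rewrite -[leLHS]mulrA -2![leRHS]mulrA ler_wpM2l //.
    rewrite mulrCA; apply: ler_pM => //.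
      exact: normr_bernoulli_moment.
    apply: (le_trans (hB _ _ _ _ p01)); first exact: leq_trans (leq_subr _ _) _.
    rewrite ler_wpM2l //; apply: ler_weXn2l; first by rewrite lerDl.
    by rewrite subSS leq_subr.
  have -> : d M.+1 - d M
    = 'C(k.+3, 2)%:R * v * (binomial_central_moment p M k.+1
          - (gaussian_moment k.+1)%:R * x ^+ k.+1)
      + S
      - ((gaussian_moment k.+3)%:R * (y ^+ k.+3 - x ^+ k.+3)
         - 'C(k.+3, 2)%:R * v * ((gaussian_moment k.+1)%:R * x ^+ k.+1)).
    have yE : M.+1%:R * (p * (1 - p)) = V + v by rewrite -natr1 /V /v; ring.
    rewrite /d yE -/v -/V -/x -/y.
    have -> : binomial_central_moment p M.+1 k.+3
      = binomial_central_moment p M k.+3 + ('C(k.+3, 2)%:R * v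
          * binomial_central_moment p M k.+1 + S).
      by rewrite -mE addrC subrK.
    ring.
  apply: (le_trans (ler_normB _ _)); rewrite /K !mulrDl; apply: lerD => //.
  apply: (le_trans (ler_normD _ _)); apply: lerD => //.
  rewrite normrM ger0_norm; last exact: mulr_ge0.
  rewrite -[leLHS]mulrA -2![leRHS]mulrA ler_wpM2l //.
  by rewrite mulrCA ler_wpM2l.
have d0 : d 0%N = 0.
  by rewrite /d binomial_central_moment_N0 mul0r sqrtr0 expr0n mulr0 subr0.
(* Over [N] increments the factor [N * p * (1 - p)] is the square of the root, which raises the
   exponent from [k] to [k.+2]. *)
apply: (le_trans (normr_telescope d0 step)) => /=.
have V0 : 0 <= N%:R * (p * (1 - p)) by rewrite mulr_ge0.
have xx0 := x0 N; have xV := sqr_sqrtr V0.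
have -> (Y : R) : N%:R * (K * (p * (1 - p)) * Y)
  = K * (Num.sqrt (N%:R * (p * (1 - p))) ^+ 2 * Y) by rewrite xV; ring.
move: (Num.sqrt _) xx0 {xV} => x xx0.
apply: ler_pM => //; first by rewrite mulr_ge0 // exprn_ge0 //; lra.
  by rewrite lerDr.
rewrite -[k.+2]add2n exprD ler_wpM2r ?exprn_ge0 //; first lra.
by rewrite lerXn2r ?nnegrE //; lra.
Qed.

(** * Reduction to the linear term *)

(** The sum equals [#|G| - N * p], and the number of edges is binomially distributed. *)
Lemma Gnp_expectation_linear {R : realType} {n : nat} (p : R) (k : nat) :
  Gnp_expectation p (fun G : {set {set 'I_n}} =>
    (\sum_(e in complete_graph n) ((e \in G)%:R - p)) ^+ k)
  = binomial_central_moment p #|complete_graph n| k.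
Proof.
set E := complete_graph n; set N := #|E|.
pose w j : R := p ^+ j * (1 - p) ^+ (N - j) * (j%:R - N%:R * p) ^+ k.
transitivity (\sum_(G : {set {set 'I_n}} | G \subset E) w #|G|).
  apply: eq_bigr => G GE; rewrite /w; congr (_ * _ ^+ k).
    rewrite /Gnp_weight (bigID (mem G)) /=; congr (_ * _).
      rewrite -prodr_const [LHS]big_mkcond [RHS]big_mkcond.
      apply: eq_bigr => e _; case: ifPn => [/andP[_ ->] //|].
      by case: ifPn => // eG; rewrite andbT (fintype.subsetP GE).
    rewrite -cardsDS // -prodr_const [LHS]big_mkcond [RHS]big_mkcond.
    by apply: eq_bigr => e _; rewrite !inE andbC; case: (e \in G).
  rewrite big_split /= sumr_const mulNrn mulr_natl; congr (_ - _).
  rewrite -sum1_card natr_sum [LHS]big_mkcond [RHS]big_mkcond.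
  apply: eq_bigr => e _; case: ifPn => eE; case: ifPn => // eG.
  by rewrite (fintype.subsetP GE) in eE.
(* Graphs are grouped by their number of edges, which is at most [N], so [inord] never takes its
   default value. *)
rewrite (partition_big (fun G : {set {set 'I_n}} => inord #|G| : 'I_N.+1) predT) //=.
apply: eq_bigr => j _; rewrite -!mulrA [RHS]mulr_natl mulrA -/(w j).
rewrite -cards_draws -sumr_const [LHS]big_mkcond [RHS]big_mkcond.
apply: eq_bigr => G _; rewrite !inE; case GE: (G \subset E) => //=.
have GN : (#|G| < N.+1)%N by rewrite ltnS subset_leq_card.
by rewrite -val_eqE /= inordK //; case: eqP => // ->.
Qed.

(** Transposing the incidence relation turns a [k]-tuple of subsets of [E] into a map from edges to
    index sets, and the weight becomes a product over edges. *)
Lemma sum_incidence_prod {R : comPzRingType} {T : finType} (k : nat)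
    (E : {set T}) (z : R) (mu : nat -> R) :
  \sum_(F : {ffun 'I_k -> {set T}} | [forall i, F i \subset E])
     (\prod_i z ^+ #|F i|) * \prod_(e in E) mu #|[set i | e \in F i]|
  = \prod_(e in E) \sum_(A : {set 'I_k}) z ^+ #|A| * mu #|A|.
Proof.
pose h (F : {ffun 'I_k -> {set T}}) := [ffun e => [set i | e \in F i]].
pose h' (f : {ffun T -> {set 'I_k}}) := [ffun i => [set e | i \in f e]].
have hK F : h' (h F) = F.
  by apply/ffunP => i; apply/setP => e; rewrite !ffunE !inE ffunE inE.
have h'K f : h (h' f) = f.
  by apply/ffunP => i; apply/setP => e; rewrite !ffunE !inE ffunE inE.
(* With this default value the sum runs over the maps that are empty off [E]. *)
rewrite (big_distr_big finset.set0).
rewrite (reindex_onto h h') => [|f _]; last exact: h'K.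
apply: eq_big => F.
  rewrite hK eqxx andbT.
  apply/forallP/pffun_onP => [FE | [supp _] i].
    split=> //; apply/fintype.subsetP => e; rewrite unfold_in ffunE; apply: contraR => eE.
    apply/eqP/setP => i; rewrite !inE; apply/negP => /(fintype.subsetP (FE i)).
    exact/negP.
  apply/fintype.subsetP => e eF; apply: (fintype.subsetP supp).
  by rewrite unfold_in ffunE; apply/set0Pn; exists i; rewrite inE.
move=> /forallP FE.
under [RHS]eq_bigr => e _ do rewrite ffunE.
rewrite big_split /=; congr (_ * _).
under [RHS]eq_bigr => e _ do rewrite -prodr_const.
rewrite (exchange_big_dep predT) //=; apply: eq_bigr => i _.
rewrite -prodr_const; apply: eq_bigl => e; rewrite inE.
by case eF: (e \in F i); rewrite ?andbF // (fintype.subsetP (FE i)).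
Qed.

(** At each edge the empty index set gives 1, singletons give 0 and all others at most [p * z ^+ 2];
    then [1 + x <= expR x]. *)
Lemma incidence_prod_le {R : realType} {T : finType} (k : nat) (E : {set T})
    (p z : R) :
  0 <= p <= 1 -> 0 <= z <= 1 ->
  \prod_(e in E) \sum_(A : {set 'I_k}) z ^+ #|A| * `|bernoulli_moment p #|A| |
  <= expR ((2 ^ k)%:R * p * z ^+ 2 * #|E|%:R).
Proof.
move=> p01 /andP[z0 z1]; have [p0 p1] := andP p01.
rewrite mulrC expRM_natl -prodr_const.
apply: ler_prod => e _; apply/andP; split.
  by apply: sumr_ge0 => A _; rewrite mulr_ge0 ?exprn_ge0.
apply: le_trans (expR_ge1Dx _).
have -> : 1 + (2 ^ k)%:R * p * z ^+ 2
  = \sum_(A : {set 'I_k}) ((A == finset.set0)%:R + p * z ^+ 2).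
  have cI : #|{: {set 'I_k}}| = (2 ^ k)%N.
    by rewrite -cardsT -finset.powersetT card_powerset cardsT card_ord.
  rewrite big_split /= sumr_const cI.
  rewrite -mulrA mulr_natl; congr (_ + _).
  by rewrite (bigD1 finset.set0) //= eqxx big1 ?addr0 // => A /negPf ->.
apply: ler_sum => A _.
have pz : 0 <= p * z ^+ 2 by rewrite mulr_ge0 ?exprn_ge0.
case cA: #|A| => [|[|j]].
- have -> : A = finset.set0 by apply/eqP; rewrite -cards_eq0 cA.
  by rewrite eqxx bernoulli_moment0 normr1 mulr1 lerDl.
- by rewrite bernoulli_moment1 normr0 mulr0 addr_ge0.
rewrite -[leLHS]add0r mulrC; apply: lerD => //; apply: ler_pM => //.
- exact: exprn_ge0.
- by apply: (le_trans (normr_bernoulli_moment p j p01)); rewrite ler_piMr //; lra.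
- by rewrite -[j.+2]addn2 exprD ler_piMl ?exprn_ge0 // exprn_ile1.
Qed.

(** Meant for [z = T^-1], [A = a * T] and small [d]. Tuples of singletons cancel in the difference,
    and any other tuple contains a coefficient that supplies the factor [d]. *)
Lemma Gnp_expectation_power_linear {R : realType} {n : nat} (p A d z : R)
    (c : {set {set 'I_n}} -> R) (k : nat) :
  0 <= p <= 1 -> 0 <= z <= 1 -> 0 <= A -> 0 <= d <= 1 ->
  (forall S : {set {set 'I_n}}, ~~ (S \subset complete_graph n) -> c S = 0) ->
  (forall S : {set {set 'I_n}}, #|S| == 1%N -> `|c S| <= A * z ^+ #|S|) ->
  (forall S : {set {set 'I_n}}, #|S| != 1%N -> `|c S| <= d * (A * z ^+ #|S|)) ->
  `|Gnp_expectation p (fun G => (\sum_S c S * centered_prod p S G) ^+ k)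
    - Gnp_expectation p (fun G =>
        (\sum_(S : {set {set 'I_n}} | #|S| == 1%N)
           c S * centered_prod p S G) ^+ k)|
  <= d * A ^+ k * expR ((2 ^ k)%:R * p * z ^+ 2 * #|complete_graph n|%:R).
Proof.
move=> p01 z01 A0 /andP[d0 d1] cE c1 cN1; have [z0 z1] := andP z01.
set E := complete_graph n.
(* Stated for arbitrary [b], to serve both [c] and its restriction to singletons. *)
have expand (b : {set {set 'I_n}} -> R) :
    (forall S : {set {set 'I_n}}, ~~ (S \subset E) -> b S = 0) ->
    Gnp_expectation p (fun G => (\sum_S b S * centered_prod p S G) ^+ k)
    = \sum_(F : {ffun 'I_k -> {set {set 'I_n}}} | [forall i, F i \subset E])
        (\prod_i b (F i)) *
        \prod_(e in E) bernoulli_moment p #|[set i | e \in F i]|.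
  move=> bE.
  transitivity (Gnp_expectation p (fun G =>
    \sum_(F : {ffun 'I_k -> {set {set 'I_n}}} | [forall i, F i \subset E])
       (\prod_i b (F i)) * \prod_i centered_prod p (F i) G)).
    apply: eq_Gnp_expectation => G _.
    rewrite -{1}(card_ord k) -prodr_const bigA_distr_bigA /=.
    rewrite [RHS]big_mkcond; apply: eq_bigr => F _; rewrite big_split /=.
    case: ifPn => // /forallPn[i FE].
    by rewrite (bigD1 i) //= bE // !mul0r.
  rewrite Gnp_expectation_sum; apply: eq_bigr => F /forallP FE.
  by rewrite Gnp_expectationZ Gnp_expectation_centered.
pose c' (S : {set {set 'I_n}}) := if #|S| == 1%N then c S else 0.
have -> : Gnp_expectation p (fun G =>
    (\sum_(S : {set {set 'I_n}} | #|S| == 1%N) c S * centered_prod p S G) ^+ k)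
  = Gnp_expectation p (fun G => (\sum_S c' S * centered_prod p S G) ^+ k).
  apply: eq_Gnp_expectation => G _; congr (_ ^+ k).
  rewrite big_mkcond; apply: eq_bigr => S _; rewrite /c'.
  by case: ifP; rewrite ?mul0r.
rewrite !expand //; last by move=> S SE; rewrite /c' cE // if_same.
rewrite -sumrB; apply: (le_trans (ler_norm_sum _ _ _)).
apply: (@le_trans _ _ (d * A ^+ k * \prod_(e in E)
   \sum_(B : {set 'I_k}) z ^+ #|B| * `|bernoulli_moment p #|B| |)); last first.
  by rewrite ler_wpM2l ?mulr_ge0 ?exprn_ge0 // incidence_prod_le.
rewrite -(@sum_incidence_prod R _ k E z (fun j => `|bernoulli_moment p j|)).
rewrite mulr_sumr; apply: ler_sum => F _.
rewrite -mulrBl normrM normr_prod mulrA ler_wpM2r ?prodr_ge0 //.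
have cA (S : {set {set 'I_n}}) : `|c S| <= A * z ^+ #|S|.
  have [/eqP/c1//|/cN1 h] := eqVneq #|S| 1%N; apply: (le_trans h).
  by rewrite ler_piMl // mulr_ge0 ?exprn_ge0.
have zk : d * A ^+ k * \prod_i z ^+ #|F i| = d * \prod_i (A * z ^+ #|F i|).
  by rewrite big_split /= prodr_const card_ord mulrA.
have [/forallP all1|/forallPn[i Fi]] := boolP [forall i, #|F i| == 1%N].
  rewrite zk [X in _ - X](eq_bigr (fun i => c (F i))) => [|i _]; last by rewrite /c' all1.
  by rewrite subrr normr0 mulr_ge0 // prodr_ge0 // => i _; rewrite mulr_ge0 ?exprn_ge0.
(* The non-singleton [F i] kills the second product and gains the factor [d] in the first. *)
rewrite [X in _ - X](bigD1 i) //= {1}/c' (negPf Fi) mul0r subr0 zk.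
rewrite normr_prod (bigD1 i) //= [in leRHS](bigD1 i) //= mulrA.
apply: ler_pM => //; first exact: prodr_ge0.
  exact: cN1.
by apply: ler_prod => j _; rewrite normr_ge0 cA.
Qed.

(** * The coefficients of the expansion *)

(** The case [r = 0] gives [(-1)!! = 1], the value of [(2l - 3)!!] at [l = 1]. *)
Lemma double_factorial_odd (R : realType) (r : nat) :
  double_factorial (2 * r%:R - 1) = (\prod_(i < r) i.*2.+1)%:R :> R.
Proof.
rewrite /double_factorial subrK mulrC mulKf ?pnatr_eq0 // Num.Theory.natrK.
rewrite natr_prod (reindex_inj rev_ord_inj); apply: eq_bigr => i _ /=.
rewrite natrB // -addnn -addn1 !natrD -natr1; ring.
Qed.

Lemma prod_odd_fact (r : nat) :
  (\prod_(i < r) i.*2.+1 * (2 ^ r * r`!) = (2 * r)`!)%N.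
Proof.
elim: r => [|r IH]; first by rewrite big_ord0.
have -> : (2 * r.+1 = (2 * r).+2)%N by lia.
by rewrite big_ord_recr /= !factS expnS -IH -mul2n; ring.
Qed.

Lemma gaussian_moment_even (r : nat) :
  gaussian_moment (2 * r) = (\prod_(i < r) i.*2.+1)%N.
Proof.
elim: r => [|r IH]; first by rewrite big_ord0.
have -> : (2 * r.+1 = (2 * r).+2)%N by lia.
by rewrite big_ord_recr /= IH mulnC mul2n.
Qed.

(** The common value of [num_extensions l S] over matchings [S] with [s <= l] edges. *)
Definition extension_count (R : realType) (n l s : nat) : R :=
  (\prod_(s <= i < l) 'C(n - 2 * i, 2))%:R / (l - s)`!%:R.

Lemma num_extensions_count {R : realType} {n l s : nat}
    {S : {set {set 'I_n}}} :
  is_matching s S -> (s <= l)%N ->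
  (num_extensions l S)%:R = extension_count R n l s.
Proof.
move=> mS sl; apply: (@mulIf _ (l - s)`!%:R).
  by rewrite pnatr_eq0 -lt0n fact_gt0.
rewrite mulfVK ?pnatr_eq0 -?lt0n ?fact_gt0 //.
by rewrite -natrM mulnC (num_extensionsE mS).
Qed.

(** Subsets of matchings are matchings. *)
Lemma num_extensions_eq0 {n l : nat} {S : {set {set 'I_n}}} :
  ~~ (is_matching #|S| S && (#|S| <= l)%N) -> num_extensions l S = 0%N.
Proof.
move=> nS; apply/eqP; rewrite cards_eq0; apply: contraNT nS => /set0Pn[M].
rewrite inE => /andP[/and3P[gM tM /eqP <-] SM].
rewrite subset_leq_card // andbT; apply/and3P; split=> //.
  exact: fintype.subset_trans gM.
apply/finset.trivIsetP => A B /(fintype.subsetP SM) AM /(fintype.subsetP SM) BM.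
by have /finset.trivIsetP := tM; apply.
Qed.

Lemma extension_count_ge0 (R : realType) (n l s : nat) :
  0 <= extension_count R n l s.
Proof. exact: divr_ge0. Qed.

(** The ratio of consecutive counts, behind both the formula for [sigma_bar] and the decay of the
    coefficients. *)
Lemma extension_countS (R : realType) (n l s : nat) : (s < l)%N ->
  'C(n - 2 * s, 2)%:R * extension_count R n l s.+1
  = (l - s)%:R * extension_count R n l s.
Proof.
move=> sl; rewrite /extension_count [in RHS]big_ltn // natrM -(subnSK sl) factS natrM.
have h1 : (l - s.+1).+1%:R != 0 :> R by rewrite pnatr_eq0.
have h2 : (l - s.+1)`!%:R != 0 :> R by rewrite pnatr_eq0 -lt0n fact_gt0.
set a := _.+1%:R in h1 *; set b := _`!%:R in h2 *.
by clearbody a b; field; rewrite h1 h2.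
Qed.

Lemma extension_count0 (R : realType) (n l : nat) :
  extension_count R n l 0
  = 'C(n, 2 * l)%:R * ((2 * l)`!%:R / (2 ^+ l * l`!%:R)).
Proof.
rewrite /extension_count subn0 big_mkord.
have h2 : l`!%:R != 0 :> R by rewrite pnatr_eq0 -lt0n fact_gt0.
have h1 : 2 ^+ l != 0 :> R by rewrite expf_neq0 // pnatr_eq0.
apply: (@mulIf _ (2 ^+ l * l`!%:R)); first exact: mulf_neq0.
rewrite -[RHS]mulrA mulfVK; last exact: mulf_neq0.
by rewrite -natrM -prod_bin2 natrM natrX; field.
Qed.

Lemma extension_count_double_factorial (R : realType) (n l : nat) :
  extension_count R n l 0
  = 'C(n, 2 * l)%:R * double_factorial (2 * l%:R - 1).
Proof.
rewrite extension_count0 double_factorial_odd -prod_odd_fact; congr (_ * _).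
rewrite natrM [X in _ * X / _]natrM natrX mulfK // -natrX -natrM.
by rewrite pnatr_eq0 -lt0n muln_gt0 fact_gt0 expn_gt0.
Qed.

(** Fixing one edge removes its two vertices from play. *)
Lemma extension_count_shift (R : realType) (n l : nat) :
  extension_count R n l.+1 1 = extension_count R (n - 2) l 0.
Proof.
rewrite /extension_count subSS big_add1 /=; congr (_%:R / _).
by apply: eq_bigr => i _; congr 'C(_, _); lia.
Qed.

Lemma card_complete_graph (n : nat) : #|complete_graph n| = 'C(n, 2).
Proof. by rewrite card_draws card_ord. Qed.

(** Counting pairs of a matching and one of its edges trades [l.+1] times the number of matchings
    for ['C(n, 2)] times the number through a given edge, which makes the radicand a square times
    ['C(n, 2) * (p * (1 - p))]. *)
Lemma sigma_barE (R : realType) (n l : nat) (p : R) : 0 <= p <= 1 ->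
  sigma_bar n l.+1 p
  = p ^+ l * extension_count R n l.+1 1
    * Num.sqrt ('C(n, 2)%:R * (p * (1 - p))).
Proof.
move=> /andP[p0 p1]; rewrite /sigma_bar.
have a0 : 0 <= p ^+ l * extension_count R n l.+1 1.
  by rewrite mulr_ge0 ?exprn_ge0 ?extension_count_ge0.
rewrite -[X in X * Num.sqrt _]ger0_norm // -sqrtr_sqr -sqrtrM ?sqr_ge0 //.
congr Num.sqrt.
have e1 : extension_count R n l.+1 1
    = 'C(n - 2, 2 * l.+1 - 2)%:R * double_factorial (2 * l.+1%:R - 3).
  rewrite extension_count_shift extension_count_double_factorial.
  congr ('C(_, _)%:R * double_factorial _); first by lia.
  by rewrite -natr1; ring.
have e0 := @extension_count_double_factorial R n l.+1.
have := @extension_countS R n l.+1 0 isT; rewrite muln0 !subn0 => e2.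
have -> : (2 * l.+1 - 1 = l + l + 1)%N by lia.
have -> : (2 * l.+1 = l + l + 2)%N by lia.
transitivity ((l.+1%:R * extension_count R n l.+1 0) * extension_count R n l.+1 1
   * (p ^+ (l + l + 1) - p ^+ (l + l + 2))).
  rewrite e0 e1 (_ : (2 * l.+1 = l + l + 2)%N); last by lia.
  ring.
by rewrite -e2 !exprD; ring.
Qed.

(** * The mean and the centered expansion *)

Lemma Gnp_expectation_centered1 {R : realType} {n : nat} (p : R)
    (S : {set {set 'I_n}}) : S \subset complete_graph n ->
  Gnp_expectation p (centered_prod p S) = (S == finset.set0)%:R.
Proof.
move=> SE.
transitivity (Gnp_expectation p
    (fun G => \prod_(i < 1) centered_prod p ((fun=> S) i) G)).
  by apply: eq_Gnp_expectation => G _; rewrite big_ord1.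
rewrite Gnp_expectation_centered //.
have [->|/set0Pn[e eS]] := eqVneq S finset.set0.
  rewrite big1 // => e _; rewrite (_ : [set i | _] = finset.set0).
    by rewrite cards0 bernoulli_moment0.
  by apply/setP => i; rewrite !inE.
rewrite (bigD1 e) ?(fintype.subsetP SE) //= (_ : [set i | _] = finset.setT).
  by rewrite cardsT card_ord bernoulli_moment1 mul0r.
by apply/setP => i; rewrite !inE.
Qed.

Lemma matching_coef_eq0 {R : realType} {n : nat} (l : nat) (p : R)
    (S : {set {set 'I_n}}) :
  ~~ (S \subset complete_graph n) -> matching_coef l p S = 0.
Proof.
move=> SE; rewrite /matching_coef num_extensions_eq0 ?mulr0 //.
by apply: contra SE => /andP[/and3P[]].
Qed.

(** Centered products over nonempty edge sets have mean 0, so only the constant term survives. *)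
Lemma mean_matchings_coef {R : realType} (n l : nat) (p : R) :
  mean_matchings n l p = matching_coef l p (finset.set0 : {set {set 'I_n}}).
Proof.
rewrite /mean_matchings.
under eq_Gnp_expectation => G _ do rewrite (num_matchings_centered p).
rewrite Gnp_expectation_sum (bigD1 finset.set0) //= big1 => [|S S0].
  by rewrite Gnp_expectationZ Gnp_expectation_centered1 ?finset.sub0set // eqxx mulr1
    addr0.
rewrite Gnp_expectationZ.
have [SE|SE] := boolP (S \subset complete_graph n).
  by rewrite Gnp_expectation_centered1 // (negPf S0) mulr0.
by rewrite matching_coef_eq0 // mul0r.
Qed.

Lemma is_matching0 (n : nat) : is_matching 0 (finset.set0 : {set {set 'I_n}}).
Proof.
apply/and3P; split; rewrite ?cards0 //; first exact: finset.sub0set.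
by apply/finset.trivIsetP => A B; rewrite inE.
Qed.

Lemma is_matching1 {n : nat} {e : {set 'I_n}} :
  e \in complete_graph n -> is_matching 1 [set e].
Proof.
move=> eE; apply/and3P; split; rewrite ?cards1 //.
  by rewrite /is_graph finset.sub1set.
apply/finset.trivIsetP => A B; rewrite !inE => /eqP -> /eqP ->.
by rewrite eqxx.
Qed.

Lemma central_moment_centered {R : realType} (n l : nat) (p : R) (k : nat) :
  central_moment n l p k = Gnp_expectation p (fun G : {set {set 'I_n}} =>
    (\sum_S (if S == finset.set0 then 0 else matching_coef l p S)
       * centered_prod p S G) ^+ k).
Proof.
apply: eq_Gnp_expectation => G _; congr (_ ^+ k).
rewrite (num_matchings_centered p) mean_matchings_coef.
rewrite (bigD1 finset.set0) //= [RHS](bigD1 finset.set0) //= eqxx mul0r add0r.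
rewrite {1}/centered_prod finset.big_set0 mulr1 [LHS]addrC addKr.
by apply: eq_bigr => S /negPf ->.
Qed.

(** * Decay of the coefficients and comparison with the binomial moments *)

Lemma bin2_le_sqr (n : nat) : ('C(n, 2) <= n ^ 2)%N.
Proof.
have := bin_ffact n 2.
by rewrite ffactnSr ffactn1 (_ : 2`! = 2)%N //; nia.
Qed.

Lemma sqr_le_bin2 (n l s : nat) : (8 * l <= n)%N -> (s < l)%N ->
  (n ^ 2 <= 8 * 'C(n - 2 * s, 2))%N.
Proof.
move=> ln sl; have := bin_ffact (n - 2 * s) 2.
rewrite ffactnSr ffactn1 (_ : 2`! = 2)%N // => h.
have [m mE] : exists m, (n - 2 * s = m.+1)%N by exists (n - 2 * s).-1; lia.
(* The bounds [s < l <= n / 8] keep [n - 2 * s - 1] at least [3 * n / 4]. *)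
have hm : (3 * n <= 4 * m)%N by lia.
by move: h; rewrite mE subn1 /= => h; nia.
Qed.

(** One more edge multiplies the coefficient by [(l - s) / (p * 'C(n - 2 * s, 2))]. The root is at
    most [n * Num.sqrt p], so its product with [l - s] is at most [eta * p * n ^+ 2], and [n ^+ 2]
    is at most [8 * 'C(n - 2 * s, 2)]. *)
Lemma matching_coef_decay {R : realType} (n l : nat) (p eta : R) :
  0 < p <= 1 -> (0 < l)%N -> 0 <= eta <= 1 / 8 ->
  l%:R <= eta * (n%:R * Num.sqrt p) ->
  [/\ (8 * l <= n)%N, 8 <= n%:R * Num.sqrt p & forall s, (s < l)%N ->
    p ^+ (l - s.+1) * extension_count R n l s.+1 * Num.sqrt ('C(n, 2)%:R * p)
    <= 8 * eta * (p ^+ (l - s) * extension_count R n l s)].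
Proof.
move=> /andP[p0 p1] l0 /andP[e0 e8] hl.
have rp : Num.sqrt p ^+ 2 = p by rewrite sqr_sqrtr // ltW.
have r0 : 0 <= Num.sqrt p by exact: sqrtr_ge0.
have l1 : 1 <= l%:R :> R by rewrite ler1n.
have n0 : 0 <= n%:R :> R by [].
have nr0 : 0 <= n%:R * Num.sqrt p by exact: mulr_ge0.
have h8 : 8 * l%:R <= n%:R * Num.sqrt p.
  have : eta * (n%:R * Num.sqrt p) <= 1 / 8 * (n%:R * Num.sqrt p).
    exact: ler_wpM2r.
  lra.
have ln : (8 * l <= n)%N.
  rewrite -(ler_nat R) natrM; apply: (le_trans h8).
  by rewrite ler_piMr // -sqrtr1 ler_wsqrtr.
split=> // [|s sl]; first lra.
have hB : n%:R ^+ 2 <= 8 * 'C(n - 2 * s, 2)%:R :> R.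
  by rewrite -natrX -natrM ler_nat (sqr_le_bin2 _ _ _ ln sl).
have B0 : 0 < 'C(n - 2 * s, 2)%:R :> R.
  have : 0 < n%:R ^+ 2 :> R by rewrite exprn_gt0 // ltr0n (leq_trans _ ln) // muln_gt0.
  lra.
have hT : Num.sqrt ('C(n, 2)%:R * p) <= n%:R * Num.sqrt p.
  rewrite -[leRHS]ger0_norm // -sqrtr_sqr ler_wsqrtr // exprMn rp.
  apply: ler_wpM2r; first exact: ltW.
  by rewrite -natrX ler_nat bin2_le_sqr.
have hlT : (l - s)%:R * Num.sqrt ('C(n, 2)%:R * p) <= 8 * eta * p * 'C(n - 2 * s, 2)%:R.
  apply: (@le_trans _ _ ((eta * (n%:R * Num.sqrt p)) * (n%:R * Num.sqrt p))).
    apply: ler_pM => //; first exact: sqrtr_ge0.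
    by apply: le_trans hl; rewrite ler_nat leq_subr.
  have -> : eta * (n%:R * Num.sqrt p) * (n%:R * Num.sqrt p) = eta * p * n%:R ^+ 2.
    by rewrite -{3}rp; ring.
  have -> : 8 * eta * p * 'C(n - 2 * s, 2)%:R = eta * p * (8 * 'C(n - 2 * s, 2)%:R).
    by ring.
  by apply: ler_wpM2l => //; rewrite mulr_ge0 // ltW.
rewrite -(ler_pM2l B0).
have := extension_countS R n l s sl.
move: (Num.sqrt ('C(n, 2)%:R * p)) hlT => T hlT ecS.
have -> : 'C(n - 2 * s, 2)%:R * (p ^+ (l - s.+1) * extension_count R n l s.+1 * T)
  = (p ^+ (l - s.+1) * extension_count R n l s) * ((l - s)%:R * T).
  transitivity (p ^+ (l - s.+1) * T * ('C(n - 2 * s, 2)%:R * extension_count R n l s.+1)).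
    by ring.
  by rewrite ecS; ring.
have -> : 'C(n - 2 * s, 2)%:R * (8 * eta * (p ^+ (l - s) * extension_count R n l s))
  = (p ^+ (l - s.+1) * extension_count R n l s) * (8 * eta * p * 'C(n - 2 * s, 2)%:R).
  by rewrite -(subnSK sl) exprS; ring.
apply: ler_wpM2l => //.
by rewrite mulr_ge0 ?exprn_ge0 ?extension_count_ge0 // ltW.
Qed.

(** By the decay, coefficients of sets with at least two edges carry a factor [8 * eta], so the
    comparison of powers applies with [d = 8 * eta]. *)
Lemma central_moment_linear {R : realType} (n l : nat) (p eta : R) (k : nat) :
  0 < p <= 1 -> (0 < l)%N -> 0 <= eta <= 1 / 8 ->
  l%:R <= eta * (n%:R * Num.sqrt p) ->
  `|central_moment n l p k
    - (p ^+ l.-1 * extension_count R n l 1) ^+ k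
        * binomial_central_moment p 'C(n, 2) k|
  <= 8 * eta
     * (p ^+ l.-1 * extension_count R n l 1 * Num.sqrt ('C(n, 2)%:R * p)) ^+ k
     * expR (2 ^ k)%:R.
Proof.
move=> p01 l0 e01 hl; have [p0 p1] := andP p01; have [e0 e8] := andP e01.
have [ln h8 decay] := matching_coef_decay _ _ _ _ p01 l0 e01 hl.
set a := p ^+ l.-1 * _; set T := Num.sqrt _.
have a0 : 0 <= a.
  by rewrite mulr_ge0 ?exprn_ge0 ?extension_count_ge0 // ltW.
have Np0 : 0 <= 'C(n, 2)%:R * p by rewrite mulr_ge0 // ltW.
have T2 : T ^+ 2 = 'C(n, 2)%:R * p by rewrite /T sqr_sqrtr.
have T0' : 0 <= T by exact: sqrtr_ge0.
(* Ensures [z = T^-1 <= 1]; it comes from [8 <= n * Num.sqrt p]. *)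
have T1 : 1 <= T.
  have h := sqr_le_bin2 n l 0 ln l0; rewrite muln0 subn0 in h.
  have {}h : n%:R ^+ 2 * p <= 8 * 'C(n, 2)%:R * p.
    by rewrite ler_wpM2r ?(ltW p0) // -natrX -natrM ler_nat.
  have : (n%:R * Num.sqrt p) ^+ 2 = n%:R ^+ 2 * p.
    by rewrite exprMn sqr_sqrtr // ltW.
  move: T2; rewrite -/T; nra.
have T0 : T != 0 by lra.
pose c (S : {set {set 'I_n}}) :=
  if S == finset.set0 then 0 else matching_coef l p S.
pose C s := p ^+ (l - s) * extension_count R n l s.
have C1 : C 1%N = a by rewrite /C subn1.
have C0 s : 0 <= C s.
  by rewrite mulr_ge0 ?exprn_ge0 ?extension_count_ge0 // ltW.
(* Iterates the decay, starting from the singleton coefficient [a]. *)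
have CT s : (s < l)%N -> C s.+1 * T ^+ s.+1 <= (8 * eta) ^+ s * (a * T).
  elim: s => [|s IH] sl; first by rewrite C1 expr0 mul1r.
  rewrite (exprS T) [leLHS]mulrA (exprS (8 * eta)) -[leRHS]mulrA.
  apply: (@le_trans _ _ (8 * eta * C s.+1 * T ^+ s.+1)).
    rewrite ler_wpM2r ?exprn_ge0 //; have := decay _ sl.
    by rewrite -/(C s.+1) -/(C s.+2) mulrA.
  rewrite -[leLHS]mulrA ler_wpM2l ?IH //; last exact: ltnW.
  by rewrite mulr_ge0.
have AT0 (S : {set {set 'I_n}}) : 0 <= a * T * T^-1 ^+ #|S|.
  by apply: mulr_ge0; [exact: mulr_ge0 | rewrite exprn_ge0 // invr_ge0].
have cC (S : {set {set 'I_n}}) : S != finset.set0 ->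
    `|c S| <= (8 * eta) ^+ #|S|.-1 * (a * T * T^-1 ^+ #|S|).
  move=> S0; rewrite /c (negPf S0).
  have e80 : 0 <= 8 * eta by rewrite mulr_ge0.
  have Tm0 := AT0 S.
  have [/andP[mS sl]|nS] := boolP (is_matching #|S| S && (#|S| <= l)%N); last first.
    rewrite /matching_coef num_extensions_eq0 // mulr0 normr0.
    by rewrite mulr_ge0 ?exprn_ge0.
  rewrite /matching_coef (num_extensions_count mS sl) -/(C #|S|) ger0_norm //.
  move: S0; rewrite -card_gt0; case: #|S| sl => // s sl _ /=.
  have Ts0 : 0 < T ^+ s.+1 by rewrite exprn_gt0 // (lt_le_trans ltr01).
  by rewrite exprVn [leRHS]mulrA ler_pdivlMr //; apply: CT.
have -> : (a ^+ k * binomial_central_moment p 'C(n, 2) k)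
  = Gnp_expectation p (fun G => (\sum_(S : {set {set 'I_n}} | #|S| == 1%N)
           c S * centered_prod p S G) ^+ k).
  rewrite -card_complete_graph -Gnp_expectation_linear -Gnp_expectationZ.
  apply: eq_Gnp_expectation => G _; rewrite -exprMn; congr (_ ^+ k).
  rewrite mulr_sumr.
  transitivity (\sum_(e : {set 'I_n}) c [set e] * centered_prod p [set e] G).
    rewrite big_mkcond; apply: eq_bigr => e _.
    have e0' : [set e] != finset.set0 by apply/set0Pn; exists e; rewrite inE.
    rewrite /c (negPf e0'); case: ifPn => eE; last first.
      by rewrite matching_coef_eq0 ?mul0r // finset.sub1set.
    rewrite /matching_coef (num_extensions_count (is_matching1 eE)) // cards1.
    by rewrite /centered_prod finset.big_set1 subn1.
  (* Inverse of [e |-> [set e]] on singletons, where the default of [odflt] is never reached. *)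
  pose h (S : {set {set 'I_n}}) := odflt finset.set0 [pick e in S].
  rewrite [RHS](reindex_onto (fun e => [set e]) h) => [|S /cards1P[e ->]].
    apply: eq_bigl => e; rewrite cards1 eqxx /h; case: pickP => [f|/(_ e)].
      by rewrite inE => /eqP ->; rewrite eqxx.
    by rewrite inE eqxx.
  rewrite /h; case: pickP => [f|/(_ e)]; last by rewrite inE eqxx.
  by rewrite inE => /eqP ->.
rewrite central_moment_centered.
(* Since [T ^+ 2 = 'C(n, 2) * p], the exponent does not depend on [n] or [p]. *)
have -> : (2 ^ k)%:R = (2 ^ k)%:R * p * T^-1 ^+ 2 * #|complete_graph n|%:R :> R.
  rewrite card_complete_graph exprVn -[LHS]mulr1 -!mulrA; congr (_ * _).
  by rewrite mulrCA [p * _]mulrC -T2 mulVf // expf_neq0.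
apply: Gnp_expectation_power_linear; rewrite ?(ltW p0) ?p1 //.
- by rewrite invr_ge0 T0' invf_le1 //; lra.
- by rewrite mulr_ge0.
- by rewrite mulr_ge0 //=; lra.
- by move=> S SE; case: ifP => // _; apply: matching_coef_eq0.
- move=> S /eqP S1; have := cC S; rewrite S1 expr0 mul1r; apply.
  by rewrite -card_gt0 S1.
- move=> S S1; have [->|S0] := eqVneq S finset.set0.
    by rewrite normr0; apply: mulr_ge0 (AT0 _); apply: mulr_ge0.
  (* Here [#|S| >= 2] and [8 * eta <= 1], so one factor [8 * eta] is kept and the others are bounded
     by 1. *)
  have := cC S S0; rewrite /c (negPf S0) => /le_trans; apply.
  rewrite ler_wpM2r //.
  have : (1 < #|S|)%N by rewrite ltn_neqAle eq_sym S1 card_gt0.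
  case: #|S| => [|[|s]] // _; rewrite exprS ler_piMr ?mulr_ge0 //.
  by rewrite exprn_ile1 ?mulr_ge0 //; lra.
Qed.

(** A non-asymptotic form of both parities, with [eta] in the role of [o(1)]. In the constant, [K1]
    pays for the nonlinear terms and [K2] for the normal approximation of the binomial moment. *)
Lemma central_moment_bound {R : realType} (c : R) (k : nat) :
  0 < c -> (0 < k)%N ->
  exists2 K : R, 0 < K & forall (n l : nat) (p eta : R),
    0 < p < 1 -> c <= 1 - p -> (0 < l)%N -> 0 <= eta <= 1 / 8 ->
    l%:R <= eta * (n%:R * Num.sqrt p) ->
    `|central_moment n l p k - (gaussian_moment k)%:R * sigma_bar n l p ^+ k|
      <= K * eta * sigma_bar n l p ^+ k.
Proof.
move=> c0 k0.
have [M M0 hM] := @binomial_central_moment_approx R k.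
set u := Num.sqrt c.
have u0 : 0 < u by rewrite sqrtr_gt0.
have ui0 : 0 < u^-1 by rewrite invr_gt0.
(* Chosen to give [1 <= kap * eta * x] for [x] the root of ['C(n, 2) * (p * (1 - p))]: one has [1 <=
   l <= eta * (n * Num.sqrt p) <= 3 * eta * T] and [T <= u^-1 * x]. *)
pose kap := 3 * u^-1.
have kap0 : 0 < kap by rewrite mulr_gt0.
pose K1 := 8 * expR (2 ^ k)%:R * u^-1 ^+ k.
pose K2 := M * (kap + 1) ^+ k.
have K10 : 0 < K1 by rewrite !mulr_gt0 ?expR_gt0 ?exprn_gt0.
have K20 : 0 <= K2 by rewrite mulr_ge0 ?exprn_ge0 //; lra.
exists (K1 + K2) => [|n l p eta p01 cp l0 e01 hl]; first by rewrite ltr_wpDr.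
have [p0 p1] := andP p01; have [e0 e8] := andP e01.
have p01' : 0 < p <= 1 by rewrite p0 ltW.
have p01'' : 0 <= p <= 1 by rewrite ltW //= ltW.
have [ln h8 _] := matching_coef_decay _ _ _ _ p01' l0 e01 hl.
have main := central_moment_linear _ _ _ _ k p01' l0 e01 hl.
have approx := hM k 'C(n, 2) p (leqnn k) p01''.
have sE : sigma_bar n l p = p ^+ l.-1 * extension_count R n l 1
    * Num.sqrt ('C(n, 2)%:R * (p * (1 - p))).
  by case: l l0 {hl ln main} => // l _; rewrite sigma_barE.
rewrite sE.
have a0 : 0 <= p ^+ l.-1 * extension_count R n l 1.
  by rewrite mulr_ge0 ?exprn_ge0 ?extension_count_ge0 // ltW.
have Np0 : 0 <= 'C(n, 2)%:R * p by rewrite mulr_ge0 // ltW.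
have x0 : 0 <= Num.sqrt ('C(n, 2)%:R * (p * (1 - p))) by exact: sqrtr_ge0.
have T0 : 0 <= Num.sqrt ('C(n, 2)%:R * p) by exact: sqrtr_ge0.
(* Here [c <= 1 - p] enters: dropping the factor [1 - p] under the root costs only a constant. *)
have xT : Num.sqrt ('C(n, 2)%:R * p) <= u^-1 * Num.sqrt ('C(n, 2)%:R * (p * (1 - p))).
  rewrite [leRHS]mulrC ler_pdivlMr // mulrA [leRHS]sqrtrM // ler_wpM2l // /u.
  by rewrite ler_wsqrtr.
have T3 : 1 <= 3 * (eta * Num.sqrt ('C(n, 2)%:R * p)).
  have nr : n%:R * Num.sqrt p <= 3 * Num.sqrt ('C(n, 2)%:R * p).
    have h := sqr_le_bin2 n l 0 ln l0; rewrite muln0 subn0 in h.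
    have h9 : n%:R ^+ 2 <= 9 * 'C(n, 2)%:R :> R.
      by rewrite -natrX -natrM ler_nat (leq_trans h) // leq_mul2r orbT.
    have -> : 3 * Num.sqrt ('C(n, 2)%:R * p) = Num.sqrt (9 * 'C(n, 2)%:R * p).
      rewrite -[9 * _ * p]mulrA [RHS]sqrtrM // (_ : 9 = 3 ^+ 2); last by ring.
      by rewrite sqrtr_sqr ger0_norm.
    have -> : n%:R * Num.sqrt p = Num.sqrt (n%:R ^+ 2 * p).
      by rewrite sqrtrM ?sqr_ge0 // sqrtr_sqr ger0_norm.
    by rewrite ler_wsqrtr // ler_wpM2r // ltW.
  have l1 : 1 <= l%:R :> R by rewrite ler1n.
  have := ler_wpM2l e0 nr; lra.
move: (p ^+ l.-1 * _) (central_moment n l p k) (binomial_central_moment _ _ _)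
  (Num.sqrt ('C(n, 2)%:R * (p * (1 - p)))) (Num.sqrt ('C(n, 2)%:R * p))
  (gaussian_moment k)%:R a0 x0 T0 xT T3 main approx
  => a m b x T g a0 x0 T0 xT T3 main approx.
have -> : m - g * (a * x) ^+ k = (m - a ^+ k * b) + a ^+ k * (b - g * x ^+ k).
  by rewrite exprMn; ring.
apply: (le_trans (ler_normD _ _)); rewrite !mulrDl; apply: lerD.
  apply: (le_trans main).
  have -> : K1 * eta * (a * x) ^+ k
      = 8 * eta * (a * (u^-1 * x)) ^+ k * expR (2 ^ k)%:R.
    by rewrite /K1 !exprMn; ring.
  apply: ler_wpM2r; first exact: expR_ge0.
  apply: ler_wpM2l; first exact: mulr_ge0.
  by rewrite lerXn2r ?nnegrE ?mulr_ge0 ?ler_wpM2l // ltW.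
rewrite normrM ger0_norm ?exprn_ge0 // /K2 exprMn.
have etax : 1 <= kap * eta * x.
  apply: (le_trans T3); rewrite /kap -!mulrA ler_wpM2l // mulrCA.
  by rewrite ler_wpM2l.
have e1 : eta <= 1 by lra.
have kapx : 1 + x <= (kap + 1) * x.
  have : kap * eta * x <= kap * 1 * x.
    by rewrite ler_wpM2r // ler_wpM2l // ltW.
  lra.
have -> : M * (kap + 1) ^+ k * eta * (a ^+ k * x ^+ k)
  = a ^+ k * (M * ((kap + 1) ^+ k * eta * x ^+ k)) by ring.
apply: ler_wpM2l; first exact: exprn_ge0.
apply: (le_trans approx); apply: ler_wpM2l => //.
(* The approximation error has only [k.-1] powers of [1 + x]; the factor [kap * eta * x >= 1]
   supplies the missing power together with [eta]. *)
rewrite -(prednK k0) /= !(exprS _ k.-1).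
apply: (@le_trans _ _ (((kap + 1) * x) ^+ k.-1 * (kap * eta * x))).
  rewrite -[leLHS]mulr1; apply: ler_pM => //; first by rewrite exprn_ge0; lra.
  by rewrite lerXn2r ?nnegrE //; lra.
have -> : (kap + 1) * (kap + 1) ^+ k.-1 * eta * (x * x ^+ k.-1)
  = ((kap + 1) * x) ^+ k.-1 * (kap * eta * x)
    + ((kap + 1) * x) ^+ k.-1 * (eta * x) by rewrite exprMn; ring.
rewrite lerDl; apply: mulr_ge0; last exact: mulr_ge0.
by apply: exprn_ge0; lra.
Qed.

(** * Passage to the limit *)

Lemma double_factorial_gaussian {R : realType} (k : nat) :
  (0 < k)%N -> ~~ odd k ->
  double_factorial (k%:R - 1) = (gaussian_moment k)%:R :> R.
Proof.
move=> k0 ek; have -> : k = (2 * k./2)%N by lia.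
by rewrite natrM double_factorial_odd gaussian_moment_even.
Qed.

Lemma gaussian_moment_even_gt0 (k : nat) : ~~ odd k -> (0 < gaussian_moment k)%N.
Proof.
move=> ek; have -> : k = (2 * k./2)%N by lia.
by rewrite gaussian_moment_even prodn_gt0.
Qed.

Local Open Scope classical_set_scope.
Local Open Scope ring_scope.

Theorem theorem1 (R : realType) (p : nat -> R) (l : nat -> nat)
  (p01 : forall n : nat, 0 < p n < 1)
  (p_away1 : exists2 c : R, 0 < c & forall n : nat, c <= 1 - p n)
  (l_gt0 : forall n : nat, (0 < l n)%N)
  (l_small : (fun n : nat => (l n)%:R : R) =o_\oo
             (fun n : nat => n%:R * Num.sqrt (p n)))
  (k : nat) (k_ge2 : (2 <= k)%N) :
  (forall n : nat, mean_matchings n (l n) (p n) =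
     'C(n, 2 * l n)%:R * ((2 * l n)`!%:R / (2 ^+ l n * (l n)`!%:R))
       * p n ^+ l n)
  /\ (~~ odd k ->
        (fun n : nat => central_moment n (l n) (p n) k) ~_\oo
        (fun n : nat => double_factorial (k%:R - 1)
                          * sigma_bar n (l n) (p n) ^+ k))
  /\ (odd k ->
        (fun n : nat => central_moment n (l n) (p n) k) =o_\oo
        (fun n : nat => sigma_bar n (l n) (p n) ^+ k)).
Proof.
have k0 : (0 < k)%N by exact: leq_trans k_ge2.
split => [n|].
  rewrite mean_matchings_coef /matching_coef cards0 subn0.
  by rewrite (num_extensions_count (is_matching0 n)) // extension_count0 mulrC.
have [c c0 hc] := p_away1.
have [K K0 hK] := central_moment_bound c k c0 k0.
have small (eps : R) : 0 < eps -> \forall n \near \oo,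
    `|central_moment n (l n) (p n) k
        - (gaussian_moment k)%:R * sigma_bar n (l n) (p n) ^+ k|
    <= eps * `|sigma_bar n (l n) (p n) ^+ k|.
  move=> eps0.
  (* The first entry meets the hypothesis of [central_moment_bound]; the second makes
     [K * eta <= eps]. *)
  pose eta := Num.min (1 / 8) (eps / K).
  have eta0 : 0 < eta by rewrite lt_min !divr_gt0.
  have eta8 : eta <= 1 / 8 by rewrite ge_min lexx.
  have etaK : K * eta <= eps by rewrite mulrC -ler_pdivlMr // ge_min lexx orbT.
  move/eqoP/(_ _ eta0): l_small; apply: filterS => n.
  rewrite normr_nat ger0_norm; last by rewrite mulr_ge0 ?sqrtr_ge0.
  move=> hl; apply: (le_trans (hK n (l n) (p n) eta _ _ _ _ hl)) => //.
    by rewrite ltW.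
  apply: (le_trans (ler_norm _)); rewrite normrM ler_wpM2r //.
  by rewrite ger0_norm // mulr_ge0 // ltW.
split=> [ek|ok].
  apply/eqaddoP => eps eps0; have := small eps eps0; apply: filterS => n.
  rewrite double_factorial_gaussian // => /le_trans; apply.
  (* For even [k] the Gaussian moment is at least 1, so an error small relative to the power of
     [sigma_bar] is also small relative to the claimed main term. *)
  rewrite ler_wpM2l ?(ltW eps0) // normrM normr_nat ler_peMl //.
  by rewrite ler1n gaussian_moment_even_gt0.
apply/eqoP => eps eps0; have := small eps eps0; apply: filterS => n.
by rewrite gaussian_moment_odd // mul0r subr0.
Qed.
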